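(* Let $\mathbf A\in G^n$ be of type $(h,t)$. There exist unique elements $\mathbf A_1,\mathbf A_2\in G^n$ with the following properties: (i) $\mathbf A_1$ is of type $(h,0)$; (ii) the first $h$ and the last $n-h-t$ coordinates of $\mathbf A_2$ are the identity matrix, and the remaining $t$ coordinates (in the middle) are of $t$-type; (iii) $\mathbf A=\mathbf A_1\cdot\mathbf A_2$. Moreover, $R_{\mathbf A}=R_{\mathbf A_1}\cap R_{\mathbf A_2}$ and, in particular, $R_{\mathbf A}$ is the $\mathbb F_q$-algebra generated by the elements of $M_{\mathbf A_1}^*\cup L(h,t)\cup V_{h+t}$.
   Context: $\mathbb F_q$ is the finite field with $q$ elements, $q$ a power of a prime $p$; $\mathcal A_n=\mathbb F_q[x_1,\ldots,x_n]$, $n\ge1$; $\mathbb N$ contains $0$. $G\le \mathrm{GL}_2(\mathbb F_q)$ is the group of matrices $\begin{pmatrix}a&b\\0&1\end{pmatrix}$ with $a\ne0$, and $G^n$ is the direct product of $n$ copies. For $\mathbf A=(A_1,\ldots,A_n)\in G^n$, $A_i=\begin{pmatrix}a_i&b_i\\0&1\end{pmatrix}$, and $f\in\mathcal A_n$, $\mathbf A\circ f:=f(a_1x_1+b_1,\ldots,a_nx_n+b_n)$ and $R_{\mathbf A}:=\{f\in\mathcal A_n:\mathbf A\circ f=f\}$. An element of $G$ is of $h$-type if it equals $\begin{pmatrix}a&0\\0&1\end{pmatrix}$ with $a\neq0,1$, and of $t$-type if it equals $\begin{pmatrix}1&1\\0&1\end{pmatrix}$. For nonnegative integers $h,t$ with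 $h+t\le n$, $\mathbf A\in G^n$ is of type $(h,t)$ if its first $h$ coordinates are of $h$-type, the following $t$ are of $t$-type and the remaining $n-h-t$ are the identity matrix. For $\mathbf B$ of type $(h,0)$ with $h\ge1$, let $a_i$ be the upper-left entry of its $i$-th coordinate ($1\le i\le h$) and $d_i=\mathrm{ord}(a_i)$ the multiplicative order. $M_{\mathbf B}$ is the set of monomials $x_1^{b_1}\cdots x_h^{b_h}$ with $(b_1,\ldots,b_h)\in\mathbb N^h$ nonzero, $b_i\le d_i$ for all $i$, and $a_1^{b_1}\cdots a_h^{b_h}=1$. $M_{\mathbf B}^*$ is the set of monomials in $M_{\mathbf B}$ not divisible by any other element of $M_{\mathbf B}$. If $h=0$, $M^*_{\mathbf B}=\emptyset$. $L(h,0)=\emptyset$, $L(h,1)=\{x_{h+1}^p-x_{h+1}\}$, and for $t\ge2$, $L(h,t)=\{x_{h+1}-x_{h+2},\ldots,x_{h+t-1}-x_{h+t},\,x_{h+t}^p-x_{h+t}\}$. $V_n=\emptyset$ and $V_d=\{x_{d+1},\ldots,x_n\}$ for $0\le d\le n-1$. *)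

(* Defs.v *)
From HB Require Import structures.
From mathcomp Require Import all_boot all_order all_algebra all_fingroup.
From mathcomp Require Import mpoly.

Set Implicit Arguments.
Unset Strict Implicit.
Unset Printing Implicit Defensive.

Import GRing.Theory.

Local Open Scope ring_scope.

Section AffineGroup.

Variable F : finFieldType.

Definition aff_mx (a b : F) : 'M[F]_2 :=
  \matrix_(i, j) if i == 0 then (if j == 0 then a else b) else (j == 1)%:R.

Definition affG : {set {'GL_2[F]}} :=
  [set g : {'GL_2[F]} | [exists a : F, exists b : F, (a != 0) && (GLval g == aff_mx a b)]].

Lemma mul_aff_mx a b c d :
  aff_mx a b *m aff_mx c d = aff_mx (a * c) (a * d + b).
Proof.
apply/matrixP => i j; rewrite !mxE !big_ord_recl big_ord0 !mxE /=.
case: i => [[|[|k]] //= _]; case: j => [[|[|l]] //= _].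
- by rewrite mulr0 !addr0.
- by rewrite mulr1 addr0.
- by rewrite mul0r mulr0 !addr0.
- by rewrite mul0r mul1r add0r addr0.
Qed.

Lemma affG_group_set : group_set affG.
Proof.
apply/group_setP; split=> [|x y].
  rewrite inE; apply/existsP; exists 1; apply/existsP; exists 0.
  rewrite oner_eq0 /=; apply/eqP/matrixP => i j; rewrite !mxE.
  by case: i => [[|[|k]] lk] //; case: j => [[|[|l]] ll].
rewrite !inE => /existsP[a /existsP[b /andP[a0 /eqP xE]]].
move=> /existsP[c /existsP[d /andP[c0 /eqP yE]]].
apply/existsP; exists (a * c); apply/existsP; exists (a * d + b).
by rewrite mulf_neq0 //= -mul_aff_mx -xE -yE; apply/eqP.
Qed.

Canonical affG_group := Group affG_group_set.

Definition h_type (g : {'GL_2[F]}) : bool :=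
  [exists a : F, [&& a != 0, a != 1 & GLval g == aff_mx a 0]].

Definition t_type (g : {'GL_2[F]}) : bool := GLval g == aff_mx 1 1.

(* Multiplicative order of a nonzero scalar (junk value 1 at 0). *)
Definition mulord (a : F) : nat := #[insubd (1%g : {unit F}) a]%g.

End AffineGroup.

Section Action.

Variables (F : finFieldType) (n : nat).

(* The ambient group GL_2(F)^n, with its componentwise product. *)
Notation GLn := {dffun forall i : 'I_n, {'GL_2[F]}}.

Definition affGn : {set GLn} := setXn (fun _ : 'I_n => affG F).

Definition ulc (A : GLn) (i : 'I_n) : F := A i 0 0.
Definition urc (A : GLn) (i : 'I_n) : F := A i 0 1.

Definition aff_act (A : GLn) (f : {mpoly F[n]}) : {mpoly F[n]} :=
  f \mPo [tuple ulc A i *: 'X_i + (urc A i)%:MP | i < n].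

Definition fixed_ring (A : GLn) : {pred {mpoly F[n]}} :=
  [pred f | aff_act A f == f].

(* Variables are numbered from 0: the k-th variable x_k is 'X_i with i = k - 1. *)
Definition of_type (h t : nat) (A : GLn) : Prop :=
  [/\ A \in affGn, (h + t <= n)%N &
      forall i : 'I_n,
        [/\ (i < h)%N -> h_type (A i),
            (h <= i < h + t)%N -> t_type (A i) &
            (h + t <= i)%N -> A i = 1%g]].

Definition monM (h : nat) (B : GLn) : {pred 'X_{1..n}} :=
  [pred m : 'X_{1..n} |
    [&& m != 0%MM,
        [forall i : 'I_n, (h <= i)%N ==> (m i == 0%N)],
        [forall i : 'I_n, (i < h)%N ==> (m i <= mulord (ulc B i))%N] &
        \prod_(i < n | (i < h)%N) ulc B i ^+ m i == 1]].

(* (m' <= m)%MM is divisibility of monomials.  For h = 0 no monomial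
   satisfies monM, hence Mstar is empty. *)
Definition Mstar (h : nat) (B : GLn) (f : {mpoly F[n]}) : Prop :=
  exists m : 'X_{1..n},
    [/\ m \in monM h B,
        forall m', m' \in monM h B -> (m' <= m)%MM -> m' = m &
        f = 'X_[m]].

(* The differences are present only for t >= 2, the last element for t >= 1. *)
Definition Lset (p h t : nat) (f : {mpoly F[n]}) : Prop :=
  (exists i j : 'I_n,
     [/\ (h <= i)%N, j = i.+1 :> nat, (j < h + t)%N & f = 'X_i - 'X_j])
  \/ (exists i : 'I_n,
     [/\ (0 < t)%N, i.+1 = (h + t)%N & f = 'X_i ^+ p - 'X_i]).

Definition Vset (d : nat) (f : {mpoly F[n]}) : Prop :=
  exists2 i : 'I_n, (d <= i)%N & f = 'X_i.

Inductive gen_alg (S : {mpoly F[n]} -> Prop) : {mpoly F[n]} -> Prop :=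
| gen_alg_sub f : S f -> gen_alg S f
| gen_alg_const c : gen_alg S c%:MP
| gen_alg_add f g : gen_alg S f -> gen_alg S g -> gen_alg S (f + g)
| gen_alg_mul f g : gen_alg S f -> gen_alg S g -> gen_alg S (f * g).

Definition decomposes (h t : nat) (A A1 A2 : GLn) : Prop :=
  [/\ of_type h 0 A1,
      A2 \in affGn /\
      (forall i : 'I_n,
        [/\ (i < h)%N -> A2 i = 1%g,
            (h <= i < h + t)%N -> t_type (A2 i) &
            (h + t <= i)%N -> A2 i = 1%g]) &
      A = (A1 * A2)%g].

End Action.

Notation GLn F n := {dffun forall i : 'I_n, {'GL_2[F]}}.

(* Main.v *)
From HB Require Import structures.
Require Import Defs.
From mathcomp Require Import all_boot all_order all_algebra all_fingroup.
From mathcomp Require Import cyclic finfield.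
From mathcomp Require Import mpoly.

(* The factors A1 and A2 are forced coordinatewise and act on disjoint sets of
   variables.  With q = #|F|, the q-th iterate of A is A1, so a polynomial fixed
   by A is fixed by A1, hence by A2.  Being fixed by A1 means that every monomial
   of f restricts on the first h variables to one with a^b = 1, and such monomials
   are products of minimal ones.  Writing each variable of the translated block as
   x_i = (x_i - x) + x, with x the last variable of the block, turns f into a
   univariate polynomial in x over the integral domain {mpoly F[n]}, invariant
   under x -> x + 1, hence a polynomial in x^p - x. *)

Set Implicit Arguments.
Unset Strict Implicit.
Unset Printing Implicit Defensive.

Import GRing.Theory.

Local Open Scope ring_scope.

(** * Translation-invariant univariate polynomials in characteristic p *)

Lemma artin_schreier_translation (R : comNzRingType) (p : nat) (x : R) :
  p \in [pchar R] -> (x + 1) ^+ p - (x + 1) = x ^+ p - x.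
Proof.
move=> pcharR; rewrite -!(pFrobenius_autE pcharR) pFrobenius_autD_comm ?pFrobenius_aut1.
  by rewrite opprD addrACA subrr addr0.
exact: mulrC.
Qed.

Section Translation.

Variables (R : idomainType) (p : nat).
Hypothesis pcharR : p \in [pchar R].

Let p_prime : prime p := pcharf_prime pcharR.
Let u : {poly R} := 'X^p - 'X.

Lemma size_artin_schreier : size u = p.+1.
Proof.
by rewrite size_polyDl ?size_polyXn // size_polyN size_polyX ltnS prime_gt1.
Qed.

Lemma monic_artin_schreier : u \is monic.
Proof.
rewrite monicE lead_coefDl ?lead_coefXn //.
by rewrite size_polyN size_polyX size_polyXn ltnS prime_gt1.
Qed.

(** For [P] of degree d+1, passing from [P] to P(X+1) adds (d+1) times the leading coefficient to
    the coefficient of X^d. Invariance kills this term, and in a domain that forces d+1 = 0 in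
    [R]. *)
Lemma translation_invariant_size (P : {poly R}) :
  P \Po ('X + 1) = P -> (p %| (size P).-1)%N.
Proof.
have [->|nzP] := eqVneq P 0; first by rewrite size_poly0.
case dE: (size P).-1 => [|d] // Pinv.
have sP : size P = d.+2.
  by move: nzP; rewrite -size_poly_gt0; case: (size P) dE => // k /= ->.
have /eqP := congr1 (fun Q : {poly R} => Q`_d) Pinv.
have cE k : (('X + 1 : {poly R}) ^+ k)`_d = 'C(k, d)%:R.
  rewrite exprD1n coef_sum; have [dk|kd] := ltnP d k.+1.
    rewrite (bigD1 (Ordinal dk)) //= coefMn coefXn eqxx big1 ?addr0 // => j jd.
    by rewrite coefMn coefXn -val_eqE /= eq_sym in jd *; rewrite (negbTE jd) mul0rn.
  rewrite bin_small // big1 // => j _; rewrite coefMn coefXn gtn_eqF ?mul0rn //.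
  exact: leq_trans (ltn_ord j) kd.
(* Only the powers (X+1)^d and (X+1)^(d+1) contribute to the coefficient of X^d. *)
rewrite comp_polyE coef_sum sP !big_ord_recr /= big1 => [|i _]; last first.
  by rewrite coefZ cE bin_small ?mulr0.
rewrite add0r !coefZ !cE binn binSn mulr1 -subr_eq0 addrAC subrr add0r mulf_eq0.
have -> : P`_d.+1 = lead_coef P by rewrite lead_coefE sP.
by rewrite lead_coef_eq0 (negbTE nzP) /= -(dvdn_pcharf pcharR).
Qed.

(* Subtracting lead_coef P * (X^p - X)^(deg P / p) keeps the invariance and
   lowers the degree. *)
Lemma translation_invariant_poly (S : R -> Prop) (S0 : S 0)
    (SB : forall x y, S x -> S y -> S (x - y)) (P : {poly R}) :
  (forall i, S P`_i) -> P \Po ('X + 1) = P ->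
  exists2 Q : {poly R}, forall i, S Q`_i & P = Q \Po ('X^p - 'X).
Proof.
have SN x : S x -> S (- x) by move=> Sx; rewrite -sub0r; apply: SB.
have SD x y : S x -> S y -> S (x + y).
  by move=> Sx Sy; rewrite -[y]opprK; apply/SB/SN.
have [k] := ubnP (size P); elim: k P => // k IHk P sPk SP Pinv.
have [sP|sP] := leqP (size P) 1.
  by exists P => //; rewrite (size1_polyC sP) comp_polyC.
pose e := ((size P).-1 %/ p)%N; pose l := lead_coef P.
have eE : ((size P).-1 = e * p)%N by rewrite divnK // translation_invariant_size.
have mon_ue : u ^+ e \is monic by rewrite monic_exp // monic_artin_schreier.
have ue_size : size (u ^+ e) = size P.
  have := size_exp u e; rewrite size_artin_schreier /= mulnC -eE.
  have : (0 < size (u ^+ e))%N by rewrite size_poly_gt0 monic_neq0.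
  by case: (size P) sP => // m _; case: (size (u ^+ e)) => //= m' _ ->.
(* Multiplying by X^p - X replaces each coefficient by a difference of earlier ones or 0, so closure
   of [S] under subtraction suffices. *)
have Sue i : S (l *: u ^+ e)`_i.
  elim: (e) i => [|m IHm] i.
    rewrite expr0 coefZ coef1; case: eqP => _; rewrite ?mulr1 ?mulr0 //.
    exact: SP.
  rewrite exprS mulrBl scalerBr coefB !scalerAr coefXnM coefXM.
  by apply: SB; case: ifP.
have [|i||Q SQ QE] := IHk (P - l *: u ^+ e).
- rewrite -ltnS; apply: leq_trans sPk; rewrite ltnS -(ltn_predK sP).
  apply/leq_sizeP => j; rewrite leq_eqVlt => /predU1P[<-|ltj].
    rewrite coefB coefZ -lead_coefE -{1}ue_size -lead_coefE (monicP mon_ue).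
    by rewrite mulr1 subrr.
  rewrite coefB coefZ !nth_default ?mulr0 ?subrr ?ue_size //.
    by rewrite -(ltn_predK sP).
  by rewrite -(ltn_predK sP).
- by rewrite coefB; apply: SB.
- rewrite comp_polyB comp_polyZ rmorphXn /= Pinv /u comp_polyB comp_polyX comp_Xn_poly.
  by rewrite artin_schreier_translation ?pchar_poly.
exists (Q + l *: 'X^e) => [i|].
  rewrite coefD coefZ coefXn; apply: (SD _ _ (SQ i)).
  by case: eqP => _; rewrite ?mulr1 ?mulr0 //; apply: SP.
by rewrite comp_polyD comp_polyZ comp_Xn_poly -QE subrK.
Qed.

End Translation.

(** * Affine substitutions as algebra morphisms *)

Lemma eq_mpoly_rmorphism (R : comNzRingType) (T : comNzRingType) (n : nat)
    (phi psi : {rmorphism {mpoly R[n]} -> T}) :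
    (forall c, phi c%:MP = psi c%:MP) -> (forall i, phi 'X_i = psi 'X_i) ->
  phi =1 psi.
Proof.
move=> eqC eqX f; rewrite [f]mpolyE !rmorph_sum /=; apply: eq_bigr => m _.
rewrite -mul_mpolyC !rmorphM eqC mpolyXE_id !rmorph_prod; congr (_ * _).
by apply: eq_bigr => i _; rewrite !rmorphXn /= eqX.
Qed.

Section FixedRing.

Variables (F : finFieldType) (n : nat).
Implicit Types (A B : GLn F n) (f g : {mpoly F[n]}) (m : 'X_{1..n}).

HB.instance Definition _ A := GRing.LRMorphism.copy (aff_act A)
  (comp_mpoly [tuple ulc A i *: 'X_i + (urc A i)%:MP | i < n]).

Lemma aff_actC A c : aff_act A c%:MP = c%:MP.
Proof. exact: comp_mpolyC. Qed.

Lemma aff_actX A i : aff_act A 'X_i = ulc A i *: 'X_i + (urc A i)%:MP.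
Proof. by rewrite /aff_act comp_mpolyXU -tnth_nth tnth_mktuple. Qed.

(** The substitution is the k-th iterate of [A]. The k-th iterate of x -> ax+b has constant term
    b(1+a+...+a^(k-1)), which is kb when a = 1 and 0 when b = 0. *)
Lemma fixed_affine_power A f k :
    (forall i, ulc A i = 1 \/ urc A i = 0) -> aff_act A f = f ->
  f \mPo [tuple ulc A i ^+ k *: 'X_i + (urc A i *+ k)%:MP | i < n] = f.
Proof.
move=> A10 Af; elim: k => [|k IHk].
  rewrite -[RHS]comp_mpoly_id; congr (_ \mPo _); apply: eq_mktuple => i.
  by rewrite expr0 mulr0n scale1r mpolyC0 addr0.
rewrite -[RHS]Af -[in RHS]IHk.
apply: (eq_mpoly_rmorphism (phi := comp_mpoly _)
  (psi := aff_act A \o comp_mpoly _)) => [c|i] /=.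
  by rewrite !comp_mpolyC aff_actC.
rewrite !comp_mpolyXU -!tnth_nth !tnth_mktuple rmorphD /= aff_actC linearZ /=.
rewrite aff_actX scalerDr scalerA -exprSr -addrA -!mul_mpolyC -!mpolyCM -mpolyCD.
congr (_ + _%:MP).
by case: (A10 i) => ->; rewrite ?expr1n ?mul1r ?mulr0 ?mul0rn ?addr0 // mulrS.
Qed.

(** A diagonal substitution rescales each monomial and mixes none, so invariance can be read off
    coefficient by coefficient. *)
Lemma mcoeff_aff_act_diag A f m : (forall i, urc A i = 0) ->
  (aff_act A f)@_m = f@_m * \prod_(i < n) ulc A i ^+ m i.
Proof.
move=> A0; rewrite /aff_act comp_mpolyEX [in RHS](mpolyE f) !raddf_sum mulr_suml.
apply: eq_bigr => m' _ /=; rewrite comp_mpolyX !mcoeffZ -mulrA; congr (_ * _).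
rewrite (eq_bigr (fun i => ulc A i ^+ m' i *: 'X_i ^+ m' i)) => [|i _]; last first.
  by rewrite tnth_mktuple A0 mpolyC0 addr0 exprZn.
rewrite scaler_prod -mpolyXE_id mcoeffZ mcoeffX mulrC.
by case: eqP => [->|]; rewrite ?mul0r.
Qed.

(** * Closure properties of a generated subalgebra *)

Section Generated.

Variable S : {mpoly F[n]} -> Prop.

Lemma gen_alg0 : gen_alg S 0. Proof. by rewrite -mpolyC0; constructor. Qed.

Lemma gen_alg1 : gen_alg S 1. Proof. by rewrite -mpolyC1; constructor. Qed.

Lemma gen_algB f g : gen_alg S f -> gen_alg S g -> gen_alg S (f - g).
Proof.
move=> Sf Sg; rewrite -[- g]mulN1r -mpolyC1 -mpolyCN.
by apply: gen_alg_add => //; apply: gen_alg_mul => //; constructor.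
Qed.

Lemma gen_alg_exp f k : gen_alg S f -> gen_alg S (f ^+ k).
Proof.
move=> Sf; elim: k => [|k IHk]; first by rewrite expr0; apply: gen_alg1.
by rewrite exprS; apply: gen_alg_mul.
Qed.

Lemma gen_alg_sum (I : Type) (r : seq I) (P : pred I) (G : I -> {mpoly F[n]}) :
  (forall i, P i -> gen_alg S (G i)) -> gen_alg S (\sum_(i <- r | P i) G i).
Proof.
move=> SG; elim/big_ind: _ => //; [exact: gen_alg0 | exact: gen_alg_add].
Qed.

Definition gen_alg_coefs (P : {poly {mpoly F[n]}}) : Prop :=
  forall i, gen_alg S P`_i.

Lemma gen_alg_horner (P : {poly {mpoly F[n]}}) x :
  gen_alg_coefs P -> gen_alg S x -> gen_alg S P.[x].
Proof.
move=> SP Sx; rewrite horner_coef; apply: gen_alg_sum => i _.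
by apply: gen_alg_mul => //; apply: gen_alg_exp.
Qed.

Lemma gen_alg_coefsC f : gen_alg S f -> gen_alg_coefs f%:P.
Proof. by move=> Sf i; rewrite coefC; case: eqP => // _; apply: gen_alg0. Qed.

Lemma gen_alg_coefsX : gen_alg_coefs 'X.
Proof.
by move=> i; rewrite coefX; case: eqP => _; [apply: gen_alg1 | apply: gen_alg0].
Qed.

Lemma gen_alg_coefsD P Q :
  gen_alg_coefs P -> gen_alg_coefs Q -> gen_alg_coefs (P + Q).
Proof. by move=> SP SQ i; rewrite coefD; apply: gen_alg_add. Qed.

Lemma gen_alg_coefsM P Q :
  gen_alg_coefs P -> gen_alg_coefs Q -> gen_alg_coefs (P * Q).
Proof.
by move=> SP SQ i; rewrite coefM; apply: gen_alg_sum => j _; apply: gen_alg_mul.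
Qed.

Lemma gen_alg_coefs_exp P k : gen_alg_coefs P -> gen_alg_coefs (P ^+ k).
Proof.
move=> SP; elim: k => [|k IHk]; last by rewrite exprS; apply: gen_alg_coefsM.
by rewrite expr0; apply/gen_alg_coefsC/gen_alg1.
Qed.

End Generated.

(** * Monomials invariant under a diagonal action *)

Lemma mulord_gt0 (a : F) : (0 < mulord a)%N.
Proof. exact: order_gt0. Qed.

Lemma expr_mulord (a : F) : a != 0 -> a ^+ mulord a = 1.
Proof.
move=> nza; have := expg_order (insubd (1%g : {unit F}) a).
move/(congr1 val); rewrite FinRing.val_unitX /= insubdK // unfold_in /=.
by rewrite unitfE.
Qed.

(** These are the conditions of [monM] without the order bounds and with 0 allowed. The set is
    stable under removing a divisor that belongs to it, which the induction on degree relies on. *)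
Definition diag_invariant h B : {pred 'X_{1..n}} := [pred m : 'X_{1..n} |
  [forall i : 'I_n, (h <= i)%N ==> (m i == 0%N)] &&
  (\prod_(i < n | (i < h)%N) ulc B i ^+ m i == 1)].

(** Either [m] meets all the order bounds, or some exponent exceeds the order d of its entry, and
    then x_i^d is an invariant monomial dividing [m]. *)
Lemma exists_monM h B m : (forall i, ulc B i != 0) ->
    m \in diag_invariant h B -> m != 0%MM ->
  exists2 m', m' \in monM h B & (m' <= m)%MM.
Proof.
move=> nzB; rewrite inE => /andP[/forallP m0 m1] nzm.
have [/forallP mb|] :=
    boolP [forall i : 'I_n, (i < h)%N ==> (m i <= mulord (ulc B i))%N].
  exists m; last exact: lepm_refl.
  by rewrite inE nzm m1 andbT /=; apply/andP; split; apply/forallP.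
case/forallPn => i; rewrite negb_imply -ltnNge => /andP[ih dm].
exists (U_(i) *+ mulord (ulc B i))%MM; last first.
  apply/mnm_lepP => j; rewrite mulmnE mnm1E; case: eqP => [<-|_] /=.
    by rewrite mul1n ltnW.
  by rewrite mul0n.
rewrite inE; apply/and4P; split.
- apply/eqP => /mnmP/(_ i); rewrite mulmnE mnm1E eqxx mul1n mnm0E => d0.
  by have := mulord_gt0 (ulc B i); rewrite d0.
- apply/forallP => j; apply/implyP => hj; rewrite mulmnE mnm1E.
  case: (i =P j) => [ij|_]; last by rewrite /= mul0n.
  by rewrite -ij leqNgt ih in hj.
- apply/forallP => j; apply/implyP => _; rewrite mulmnE mnm1E.
  by case: eqP => [<-|_] /=; rewrite ?mul1n ?mul0n.
rewrite (bigD1 i) //= big1 => [|j /andP[_ ji]].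
  by rewrite mulmnE mnm1E eqxx mul1n expr_mulord ?mulr1.
by rewrite mulmnE mnm1E eq_sym (negbTE ji) mul0n expr0.
Qed.

Lemma exists_Mstar h B m : (forall i, ulc B i != 0) ->
    m \in diag_invariant h B -> m != 0%MM ->
  exists m', [/\ m' \in monM h B, (m' <= m)%MM & Mstar h B 'X_[F, m']].
Proof.
move=> nzB Bm nzm; have [m0 Mm0 m0m] := exists_monM nzB Bm nzm.
have mdegS m1 m2 : (m1 <= m2)%MM -> (mdeg m1 <= mdeg m2)%N.
  by move=> m12; rewrite -(submK m12) mdegD leq_addl.
have lt_m0 : (mdeg m0 < (mdeg m).+1)%N by rewrite ltnS mdegS.
(* Multinomials of degree at most that of [m] form a finite type, so a divisor of least degree
   exists; least degree implies minimal for divisibility. *)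
pose P (b : 'X_{1..n < (mdeg m).+1}) :=
  ((b : 'X_{1..n}) \in monM h B) && (b <= m)%MM.
have [|b /andP[Mb bm] bmin] :=
    @arg_minnP _ (BMultinom lt_m0) P (fun b => mdeg b).
  by rewrite /P /= Mm0.
exists b; split=> //; exists b; split=> // m' Mm' m'b.
have lt_m' : (mdeg m' < (mdeg m).+1)%N by rewrite ltnS mdegS // (lepm_trans m'b).
have := bmin (BMultinom lt_m'); rewrite /P /= Mm' (lepm_trans m'b bm) => /(_ isT).
rewrite -(submK m'b) mdegD -[X in (_ <= X)%N]add0n leq_add2r leqn0 mdeg_eq0.
by move=> /eqP->; rewrite add0m.
Qed.

(** Induction on the degree: split off a minimal divisor, and the quotient is again invariant. *)
Lemma gen_alg_diag_invariant h B (S : {mpoly F[n]} -> Prop) m :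
    (forall i, ulc B i != 0) -> (forall f, Mstar h B f -> S f) ->
  m \in diag_invariant h B -> gen_alg S 'X_[m].
Proof.
move=> nzB SM; have [k] := ubnP (mdeg m); elim: k m => // k IHk m mk Bm.
have [->|nzm] := eqVneq m 0%MM; first by rewrite mpolyX0; apply: gen_alg1.
have [m' [Mm' m'm SMm']] := exists_Mstar nzB Bm nzm.
rewrite -(submK m'm) mpolyXD; apply: gen_alg_mul; last exact/gen_alg_sub/SM.
move: Mm' Bm; rewrite !inE => /and4P[nzm' _ _ m'1] /andP[/forallP m0 m1].
apply: IHk.
  rewrite -ltnS; apply: leq_trans mk.
  rewrite ltnS -[in X in (_ < X)%N](submK m'm) mdegD.
  by rewrite -addn1 leq_add2l lt0n mdeg_eq0.
rewrite inE; apply/andP; split.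
  apply/forallP => i; apply/implyP => hi; rewrite mnmBE.
  by have /implyP/(_ hi)/eqP-> := m0 i.
move: m1; rewrite -[in X in X -> _](submK m'm).
under eq_bigr => i _ do rewrite mnmDE exprD.
by rewrite big_split /= (eqP m'1) mulr1.
Qed.

End FixedRing.

(** * The factorization and its coordinates *)

Section Coordinates.

Variables (F : finFieldType) (n h t : nat).
Implicit Types (A B : GLn F n) (i : 'I_n).

Definition h_part A : GLn F n :=
  [ffun i : 'I_n => if (i < h)%N then A i else 1%g].
(** The coordinates from [h + t] on are kept here too; for [A] of type (h,t) they are the
    identity. *)
Definition t_part A : GLn F n :=
  [ffun i : 'I_n => if (i < h)%N then 1%g else A i].

Lemma h_part_t_partE A : A = (h_part A * t_part A)%g.
Proof.
by apply/ffunP => i; rewrite !ffunE; case: ifP => _; rewrite ?mulg1 ?mul1g.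
Qed.

Lemma decomposes_parts A : of_type h t A -> decomposes h t A (h_part A) (t_part A).
Proof.
move=> [/setXnP AG leht Aty]; have lehn := leq_trans (leq_addr t h) leht.
split; last exact: h_part_t_partE.
  split=> [||i]; rewrite ?addn0 //.
    by apply/setXnP => i; rewrite ffunE; case: ifP => // _; apply: group1.
  rewrite ffunE; have [Ah _ _] := Aty i.
  by split=> [ih|/andP[hi ih]|hi]; [rewrite ih; apply: Ah | rewrite ltnNge hi in ih
    | rewrite ltnNge hi].
split=> [|i].
  by apply/setXnP => i; rewrite ffunE; case: ifP => // _; apply: group1.
rewrite ffunE; have [_ At A1] := Aty i; split=> [->//|hit|hti].
  by have [hi _] := andP hit; rewrite ltnNge hi; apply: At.
by rewrite ltnNge (leq_trans (leq_addr t h) hti) /= A1.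
Qed.

(** In every coordinate one of the two factors is the identity, so the other one is the coordinate
    of [A]. *)
Lemma decomposes_partsE A A1 A2 :
  decomposes h t A A1 A2 -> A1 = h_part A /\ A2 = t_part A.
Proof.
move=> [[_ _ A1ty] [_ A2ty] ->].
suff A12 i : if (i < h)%N then A2 i = 1%g else A1 i = 1%g.
  by split; apply/ffunP => i; rewrite !ffunE; have := A12 i;
    case: ifP => _ ->; rewrite ?mulg1 ?mul1g.
have [_ _] := A1ty i; have [A21 _ _] := A2ty i; rewrite addn0.
by case: ltnP => [/A21|hi ->].
Qed.

(** Translates the matrices into scalars: [A] takes its multipliers from [A1] and its translations
    from [A2], and no coordinate has both nontrivial. *)
Lemma decomposes_coordinates A A1 A2 : decomposes h t A A1 A2 ->
  forall i,
    [/\ ulc A1 i != 0, (h <= i)%N -> ulc A1 i = 1, urc A1 i = 0, ulc A2 i = 1 &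
        urc A2 i = (h <= i < h + t)%:R] /\
    (ulc A i = ulc A1 i /\ urc A i = urc A2 i).
Proof.
move=> dA i; have [[_ _ /(_ i)[A1h _ A11]] [_ /(_ i)[A21 A2t A22]] AE] := dA.
rewrite addn0 in A11.
have one_ulc : (1%g : {'GL_2[F]}) 0 0 = 1 by rewrite GL_1E mxE.
have one_urc : (1%g : {'GL_2[F]}) 0 1 = 0 by rewrite GL_1E mxE.
rewrite AE /ulc /urc ffunE; have [ih|hi] := ltnP i h.
  have /existsP[a /and3P[nza _ /eqP A1a]] := A1h ih.
  by rewrite A21 // mulg1 one_ulc one_urc A1a !mxE.
rewrite A11 // mul1g one_ulc one_urc /= oner_eq0.
have A2E : A2 i 0 0 = 1 /\ A2 i 0 1 = (i < h + t)%:R.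
  have [iht|hti] := ltnP i (h + t); last by rewrite A22 // one_ulc one_urc.
  by have /eqP-> := A2t (introT andP (conj hi iht)); rewrite !mxE.
by have [-> ->] := A2E.
Qed.

End Coordinates.

(** * The fixed rings of the factors *)

Section Decomposition.

Variables (F : finFieldType) (n h t : nat) (A A1 A2 : GLn F n).
Hypothesis dA : decomposes h t A A1 A2.

Lemma fixed_ring_decomposes :
  fixed_ring A =i [predI fixed_ring A1 & fixed_ring A2].
Proof.
have coord := decomposes_coordinates dA.
have AE f : aff_act A1 (aff_act A2 f) = aff_act A f.
  apply: (eq_mpoly_rmorphism (phi := aff_act A1 \o aff_act A2)
    (psi := aff_act A)) => [c|i] /=; first by rewrite !aff_actC.
  have [[_ _ A10 A21 _] [uA vA]] := coord i.
  by rewrite !aff_actX uA vA A21 scale1r rmorphD /= aff_actC aff_actX A10 mpolyC0 addr0.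
move=> f; rewrite !inE; apply/eqP/andP => [Af|[/eqP A1f /eqP A2f]]; last first.
  by rewrite -AE A2f A1f.
(* A^q = A1, because a^q = a in F while the translations have order p. *)
have A1f : aff_act A1 f = f.
  rewrite -[RHS](fixed_affine_power #|F| _ Af) => [|i]; last first.
    have [[_ A11 _ _ A2t] [-> ->]] := coord i; rewrite A2t.
    by case: (leqP h i) => [/A11|]; [left | right].
  rewrite /aff_act; congr (_ \mPo _); apply: eq_mktuple => i.
  have [[_ _ -> _ _] [-> _]] := coord i; rewrite expf_card.
  by rewrite -FinRing.zmodXgE -cardsT expg_cardG ?inE.
split; first exact/eqP.
(* The two factors commute, so composing in the other order also gives [A]; as [A1] fixes [f], this
   yields A2 f = A f = f. *)
have A12f : aff_act A2 (aff_act A1 f) = aff_act A f.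
  apply: (eq_mpoly_rmorphism (phi := aff_act A2 \o aff_act A1)
    (psi := aff_act A)) => [c|i] /=; first by rewrite !aff_actC.
  have [[_ A11 A10 A21 A2t] [uA vA]] := coord i.
  rewrite !aff_actX uA vA A10 mpolyC0 addr0 linearZ /= aff_actX A21 scale1r scalerDr.
  congr (_ + _); rewrite -mul_mpolyC -mpolyCM A2t.
  by case: (leqP h i) => [/A11->|]; rewrite ?mul1r ?mulr0.
by apply/eqP; rewrite -[LHS]/(aff_act A2 f) -[in LHS]A1f A12f.
Qed.

(** Comparing coefficients of [f] and its image, the nonzero coefficient cancels; the entries of
    [A1] from [h] on are 1. *)
Lemma diag_invariant_msupp f m :
    f \in fixed_ring A1 -> m \in msupp f ->
  \prod_(i < n | (i < h)%N) ulc A1 i ^+ m i = 1.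
Proof.
have coord := decomposes_coordinates dA.
move=> /eqP A1f; rewrite mcoeff_msupp => nzm.
have A10 i : urc A1 i = 0 by have [[]] := coord i.
have := mcoeff_aff_act_diag f m A10; rewrite A1f -[LHS]mulr1 => /(mulfI nzm)/esym.
rewrite (bigID (fun i : 'I_n => (i < h)%N)) /= [X in _ * X]big1 ?mulr1 // => i.
by rewrite -leqNgt; have [[_ A11 _ _ _] _] := coord i => /A11->; rewrite expr1n.
Qed.

(* On the translated block x_i = (x_i - x) + x, where the x_i - x are
   invariant: f becomes a univariate polynomial in x that is invariant under
   x -> x + 1, hence a polynomial in x^p - x. *)
Lemma fixed_ring_gen_alg (p : nat) (S : {mpoly F[n]} -> Prop) x f :
    p \in [pchar F] -> (forall g, Mstar h A1 g -> S g) ->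
    (forall i : 'I_n, (h <= i < h + t)%N -> gen_alg S ('X_i - x)) ->
    gen_alg S (x ^+ p - x) ->
    (forall i : 'I_n, (h + t <= i)%N -> gen_alg S 'X_i) ->
  f \in fixed_ring A1 -> f \in fixed_ring A2 -> gen_alg S f.
Proof.
move=> pcharF SM Sblock Sp Srest A1f /eqP A2f.
have coord := decomposes_coordinates dA.
(* Inside the block, x is replaced by a fresh indeterminate; evaluating at x recovers [f]. *)
pose y (i : 'I_n) : {poly {mpoly F[n]}} :=
  if (h <= i < h + t)%N then ('X_i - x)%:P + 'X else ('X_i)%:P.
pose Phi := mmap (polyC \o @mpolyC n F) y.
have fE : (Phi f).[x] = f.
  apply: (eq_mpoly_rmorphism (phi := horner_eval x \o Phi) (psi := idfun)) => [c|i] /=.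
    by rewrite mmapC /horner_eval hornerC.
  by rewrite mmapX mmap1U /horner_eval /y; case: ifP => _; rewrite !hornerE ?subrK.
(* On the block, [A2] adds 1 to each variable, which [Phi] turns into X -> X+1. *)
have Phi_inv : Phi f \Po ('X + 1) = Phi f.
  rewrite -[in RHS]A2f.
  apply: (eq_mpoly_rmorphism (phi := comp_poly ('X + 1) \o Phi)
    (psi := Phi \o aff_act A2)) => [c|i] /=.
    by rewrite aff_actC !mmapC comp_polyC.
  have [[_ _ _ A21 A2t] _] := coord i.
  rewrite aff_actX A21 scale1r rmorphD /= mmapC mmapX mmap1U A2t /y; case: ifP => _ /=.
    by rewrite comp_polyD comp_polyC comp_polyX addrA mpolyC1.
  by rewrite comp_polyC mpolyC0 addr0.
have Phi_coefs : gen_alg_coefs S (Phi f).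
  rewrite /Phi /mmap big_seq; elim/big_ind: _ => [||m mf].
  - by apply/gen_alg_coefsC/gen_alg0.
  - exact: gen_alg_coefsD.
  apply: gen_alg_coefsM; first by apply/gen_alg_coefsC/gen_alg_const.
  rewrite /mmap1 (bigID (fun i : 'I_n => (i < h)%N)) /=; apply: gen_alg_coefsM.
    (* [mh] truncates [m] to the first [h] variables, giving an invariant monomial. *)
    pose mh := [multinom if (i < h)%N then m i else 0%N | i < n].
    have -> : \prod_(i < n | (i < h)%N) y i ^+ m i = ('X_[mh])%:P.
      rewrite mpolyXE_id rmorph_prod big_mkcond /=; apply: eq_bigr => i _.
      rewrite mnmE /y; case: ltnP => ih; last by rewrite expr0.
      by rewrite /= rmorphXn.
    apply/gen_alg_coefsC/(gen_alg_diag_invariant (h := h) (B := A1)) => // [i|].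
      by have [[]] := coord i.
    rewrite inE -[X in _ && (X == _)]/(\prod_(i < n | (i < h)%N) ulc A1 i ^+ mh i).
    apply/andP; split.
      by apply/forallP => i; rewrite mnmE; case: ltnP.
    apply/eqP; rewrite -[RHS](diag_invariant_msupp A1f mf); apply: eq_bigr => i ih.
    by rewrite mnmE ih.
  elim/big_ind: _ => [||i]; first by apply/gen_alg_coefsC/gen_alg1.
    exact: gen_alg_coefsM.
  rewrite -leqNgt => hi; apply: gen_alg_coefs_exp; rewrite /y hi /=.
  case: ltnP => [iht|hti]; last by apply/gen_alg_coefsC/Srest.
  apply: gen_alg_coefsD (gen_alg_coefsX S).
  by apply/gen_alg_coefsC/Sblock; rewrite hi.
have pcharP : p \in [pchar {mpoly F[n]}] by rewrite pchar_lalg.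
have [Q SQ QE] := translation_invariant_poly pcharP (gen_alg0 S) (@gen_algB _ _ S)
  Phi_coefs Phi_inv.
rewrite -fE QE horner_comp; apply: gen_alg_horner => //.
by rewrite !hornerE.
Qed.

End Decomposition.

Theorem proposition3p1 (F : finFieldType) (p : nat) (pcharF : p \in [pchar F])
    (n : nat) (n_gt0 : (0 < n)%N) (h t : nat) (A : GLn F n)
    (typeA : of_type h t A) :
  (exists! A12 : GLn F n * GLn F n, decomposes h t A A12.1 A12.2) /\
  (forall A1 A2 : GLn F n, decomposes h t A A1 A2 ->
     fixed_ring A =i [predI fixed_ring A1 & fixed_ring A2] /\
     (forall f : {mpoly F[n]},
        f \in fixed_ring A <->
        gen_alg (fun g => Mstar h A1 g \/ Lset p h t g \/ Vset (h + t) g) f)).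
Proof.
split.
  exists (h_part h A, t_part h A); split; first exact: decomposes_parts.
  by move=> [A1 A2] /= /decomposes_partsE[-> ->].
move=> A1 A2 dA; have coord := decomposes_coordinates dA.
have fixE := fixed_ring_decomposes dA; split=> // f; split.
  rewrite fixE inE => /andP[A1f A2f]; set S := fun g => _.
  have SM g : Mstar h A1 g -> S g by left.
  have SV (i : 'I_n) : (h + t <= i)%N -> gen_alg S 'X_i.
    by move=> hti; apply: gen_alg_sub; right; right; exists i.
  have [t0|t_gt0] := posnP t.
    (* The translated block is empty, and x = 0 makes x^p - x vanish. *)
    apply: (fixed_ring_gen_alg (x := 0) dA pcharF SM) => // [i|].
      by rewrite t0 addn0 ltnNge andbN.
    rewrite expr0n gtn_eqF ?prime_gt0 ?(pcharf_prime pcharF) // subr0.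
    exact: gen_alg0.
  have [_ leht _] := typeA.
  (* Counting from 0, the last variable of the block has index h+t-1. *)
  have lt_s : ((h + t).-1 < n)%N by rewrite prednK // addn_gt0 t_gt0 orbT.
  pose s := Ordinal lt_s.
  have sE : s.+1 = (h + t)%N by rewrite /= prednK // addn_gt0 t_gt0 orbT.
  apply: (fixed_ring_gen_alg (x := 'X_s) dA pcharF SM) => // [i|]; last first.
    by apply: gen_alg_sub; right; left; right; exists s.
  case/andP=> hi; rewrite -sE ltnS => le_is.
  (* Telescoping: X_i - X_s is (X_i - X_(i+1)) + (X_(i+1) - X_s). *)
  have [k] := ubnP (s - i)%N; elim: k i hi le_is => // k IHk i hi le_is sik.
  have [->|ne_is] := eqVneq i s; first by rewrite subrr; apply: gen_alg0.
  have lt_is : (i < s)%N by rewrite ltn_neqAle ne_is.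
  have lt_in : (i.+1 < n)%N by apply: leq_ltn_trans lt_is lt_s.
  rewrite -[X in X - _](subrK 'X_(Ordinal lt_in)) -addrA; apply: gen_alg_add.
    apply: gen_alg_sub; right; left; left; exists i, (Ordinal lt_in).
    by split=> //=; rewrite -sE ltnS.
  apply: IHk => //=; first exact: leqW.
  by rewrite -ltnS (leq_trans _ sik) // ltnS ltn_sub2l.
have actX i : aff_act A 'X_i = ulc A1 i *: 'X_i + (h <= i < h + t)%:R.
  have [[_ _ _ _ A2t] [uA vA]] := coord i.
  by rewrite aff_actX uA vA A2t -mpolyC_nat.
have actX_block (i : 'I_n) : (h <= i < h + t)%N -> aff_act A 'X_i = 'X_i + 1.
  move=> hit; rewrite actX hit; have [[_ A11 _ _ _] _] := coord i.
  by rewrite A11 ?scale1r //; case/andP: hit.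
(* The polynomials fixed by [A] form a subalgebra, so it remains to check the generators. *)
elim=> [g|c|g1 g2 _ /eqP Ag1 _ /eqP Ag2|g1 g2 _ /eqP Ag1 _ /eqP Ag2]; last first.
- by rewrite inE rmorphM /= Ag1 Ag2.
- by rewrite inE rmorphD /= Ag1 Ag2.
- by rewrite inE aff_actC.
case=> [[m [Mm _ ->]]|[[[i [j [hi ij jht ->]]]|[i [t_gt0 iE ->]]]|[i hti ->]]];
  rewrite inE; apply/eqP.
- move: Mm; rewrite inE => /and4P[_ /forallP m0 _ /eqP m1].
  rewrite mpolyXE_id rmorph_prod /=.
  rewrite (eq_bigr (fun i => ulc A1 i ^+ m i *: 'X_i ^+ m i)) => [|i _]; last first.
    rewrite rmorphXn /= actX; have [ih|hi] := ltnP i h.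
      by rewrite addr0 exprZn.
    by have /implyP/(_ hi)/eqP-> := m0 i; rewrite !expr0 scale1r.
  rewrite scaler_prod (bigID (fun i : 'I_n => (i < h)%N)) /= m1 mul1r.
  rewrite big1 ?scale1r // => i.
  by rewrite -leqNgt => hi; have /implyP/(_ hi)/eqP-> := m0 i; rewrite expr0.
- rewrite rmorphB /= !actX_block ?jht ?andbT; last 2 first.
  + by rewrite ij leqW.
  + by rewrite hi /= (leq_trans _ jht) // ltnS ij.
  by rewrite opprD addrACA subrr addr0.
- have pcharP : p \in [pchar {mpoly F[n]}] by rewrite pchar_lalg.
  rewrite rmorphB rmorphXn /= actX_block; last first.
    by rewrite -iE ltnSn andbT -ltnS iE -addn1 leq_add2l.
  exact: artin_schreier_translation.
have [[_ A11 _ _ _] _] := coord i.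
rewrite actX A11 ?(leq_trans (leq_addr t h)) // scale1r.
by rewrite [(i < _)%N]ltnNge hti andbF addr0.
Qed.
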